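(* Let $M=(V,T)$ be a model, $AP$ a finite set of atomic propositions, and $\varphi$ a boolean combination of propositions from $AP$ describing error states. If the procedure $\mathrm{RefinementSearch}(M,\varphi)$ terminates, then: (1) if it returns a counter-example, then the counter-example is a real error, i.e. it is an execution of $\llbracket M\rrbracket$ from the initial state to a state satisfying $\varphi$ (so a state satisfying $\varphi$ is reachable in $\llbracket M\rrbracket$); (2) if it returns ''unreachable'', then no state satisfying $\varphi$ is reachable in $\llbracket M\rrbracket$, and moreover the structure $A_j$ computed in the last iteration is bisimilar to $\llbracket M\rrbracket$.
   Context: Models. $V$ is a finite set of integer variables, with tuple $\vec x$. A model is $M=(V,T)$ with $T=\{t_1,\dots,t_k\}$ a finite set of guarded commands $t_i=(g_i(\vec x)\longmapsto \vec x:=e_i(\vec x))$, where $g_i$ is a boolean guard and $e_i$ a (concurrent) assignment. A transition system over a finite set $AP$ of atomic propositions is $(S,\{\to^i\},s_0,L)$ with $S$ a possibly infinite set of states, finitely many deterministic transition relations $\to^i\subseteq S\times S$, initial state $s_0$, and labeling $L:S\to 2^{AP}$. The concrete semantics $\llbracket M\rrbracket$ has states the valuations $V\to\mathbb Z$; $s\to^i s'$ iff $s\models g_i$ and $s'=e_i(s)$; $s_0$ is the all-zero valuation; $L(s)=\{p\in AP\mid s\models p\}$, where elements of $AP$ are predicates over $V$. A state is reachable if it can be reached from $s_0$ by zero or more transitions. Bisimulation. A symmetric relation $R$ on states is a bisimulation relation iff for all $(s,s')\in R$: $L(s)=L(s')$, and for every $s\to^i s_1$ there is $s'\to^i s_1'$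 with $(s_1,s_1')\in R$. The largest one is $\sim$; two transition systems are bisimilar if their initial states are bisimilar (in the disjoint union). Abstraction. For a finite set of predicates $\Phi=\{\phi_1,\dots,\phi_n\}$ over $V$, $\alpha_\Phi(s)$ is the bitvector $b_1\dots b_n$ with $b_l=1$ iff $s\models\phi_l$; it is also identified with the formula $\bigwedge_{s\models\phi}\phi\wedge\bigwedge_{s\not\models\phi}\neg\phi$ (over $\phi\in\Phi$). Procedure $\alpha\mathrm{Search}(M,\Phi)$. Initialize $\Phi_{new}=\Phi$, $Wait=\{s_0\}$, $States=\{\alpha_\Phi(s_0)\}$, $Transitions=\emptyset$. While $Wait\ne\emptyset$: remove a state $s$ from $Wait$; set $L(\alpha_\Phi(s))=\{a\in AP\mid s\models a\}$; for each $i=1,\dots,k$: if $s\models g_i$, then (i) if $\alpha_\Phi(s)\Rightarrow g_i$ is not valid, add $g_i$ to $\Phi_{new}$; (ii) let $s'=e_i(s)$; if $\alpha_\Phi(s)\Rightarrow\alpha_\Phi(s')[e_i(\vec x)/\vec x]$ is not valid, add the predicates $\phi[e_i(\vec x)/\vec x]$, $\phi\in\Phi$, occurring in $\alpha_\Phi(s')[e_i(\vec x)/\vec x]$ to $\Phi_{new}$; (iii) if $\alpha_\Phi(s')\notin States$, add $s'$ to $Wait$ and $\alpha_\Phi(s')$ to $States$; (iv) add $(\alpha_\Phi(s),i,\alpha_\Phi(s'))$ to $Transitions$. If $s\not\models g_i$: if $\alpha_\Phi(s)\Rightarrow\neg g_i$ is not valid, add $g_i$ to $\Phi_{new}$. Return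 $(A,\Phi_{new})$ with $A=(States,Transitions,\alpha_\Phi(s_0),L)$, a transition system over $AP$. Validity is checked by a sound theorem prover; a formula whose validity it cannot decide is treated as not valid. Procedure $\mathrm{RefinementSearch}(M,\varphi)$. Set $j=1$, $\Phi_1=AP$. Loop: $(A_j,\Phi_{j+1})=\alpha\mathrm{Search}(M,\Phi_j)$; if $\varphi$ is reachable in $A_j$ (some reachable state of $A_j$ has a label satisfying $\varphi$), return a counter-example; else if $\Phi_{j+1}=\Phi_j$, return ''unreachable''; else $j:=j+1$. The counter-example is the sequence of explored concrete states leading to the visited concrete state that satisfies $\varphi$, obtained as usual from the search stack or parent pointers. *)

(* Defs.v *)
From HB Require Import structures.
From mathcomp Require Import all_boot all_order all_algebra finmap.

Set Implicit Arguments.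
Unset Strict Implicit.
Unset Printing Implicit Defensive.

Local Open Scope fset_scope.

Inductive formula (A : Type) : Type :=
| FAtom of A
| FTrue
| FNot of formula A
| FAnd of formula A & formula A
| FOr of formula A & formula A
| FImp of formula A & formula A.
Arguments FTrue {A}.

Fixpoint feval (A : Type) (v : A -> bool) (f : formula A) : bool :=
  match f with
  | FAtom p => v p
  | FTrue => true
  | FNot f1 => ~~ feval v f1
  | FAnd f1 f2 => feval v f1 && feval v f2
  | FOr f1 f2 => feval v f1 || feval v f2
  | FImp f1 f2 => feval v f1 ==> feval v f2
  end.

Fixpoint fmap_atoms (A B : Type) (h : A -> B) (f : formula A) : formula B :=
  match f with
  | FAtom p => FAtom (h p)
  | FTrue => FTrue
  | FNot f1 => FNot (fmap_atoms h f1)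
  | FAnd f1 f2 => FAnd (fmap_atoms h f1) (fmap_atoms h f2)
  | FOr f1 f2 => FOr (fmap_atoms h f1) (fmap_atoms h f2)
  | FImp f1 f2 => FImp (fmap_atoms h f1) (fmap_atoms h f2)
  end.

Fixpoint atoms (A : Type) (f : formula A) : seq A :=
  match f with
  | FAtom p => [:: p]
  | FTrue => [::]
  | FNot f1 => atoms f1
  | FAnd f1 f2 | FOr f1 f2 | FImp f1 f2 => atoms f1 ++ atoms f2
  end.

Definition fconj (A : Type) (fs : seq (formula A)) : formula A :=
  foldr (@FAnd A) FTrue fs.

Definition valuation (V : finType) : choiceType := {ffun V -> int}.

(* The syntax of expressions and predicates over V is left open.  Predicates  *)
(* are syntactic objects, compared up to syntactic equality; subst p e stands *)
(* for p[e(x)/x], and substP is the only thing required of it.                *)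
Record language (V : finType) := Language {
  expr : Type;
  expr_val : expr -> valuation V -> int;
  predicate : choiceType;
  holds : valuation V -> predicate -> bool;
  subst : predicate -> (V -> expr) -> predicate;
  substP : forall s p (e : V -> expr),
    holds s (subst p e) = holds [ffun x => expr_val (e x) s] p
}.

Definition assign (V : finType) (Lg : language V) (e : V -> expr Lg)
    (s : valuation V) : valuation V :=
  [ffun x => expr_val (e x) s].

Record model (V : finType) (Lg : language V) := Model {
  ncmd : nat;
  guard : 'I_ncmd -> predicate Lg;
  update : 'I_ncmd -> V -> expr Lg
}.

Record transition_system (I : finType) (AP : finType) := TransitionSystem {
  ts_state : Type;
  ts_trans : I -> ts_state -> ts_state -> Prop;
  ts_init : ts_state;
  ts_label : ts_state -> {set AP};
  ts_det : forall i x y z, ts_trans i x y -> ts_trans i x z -> y = z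
}.

Section TransitionSystems.
Variables (I AP : finType).
Implicit Types A B : transition_system I AP.

Fixpoint ts_path A (x : ts_state A) (p : seq (ts_state A)) : Prop :=
  if p is y :: p' then (exists i, ts_trans i x y) /\ ts_path y p' else True.

Definition ts_execution A (t : seq (ts_state A)) : Prop :=
  if t is x :: p then x = ts_init A /\ ts_path x p else False.

Definition ts_reachable A (x : ts_state A) : Prop :=
  exists2 p, ts_path (ts_init A) p & last (ts_init A) p = x.

Definition bisimulation (S : Type) (tr : I -> S -> S -> Prop)
    (L : S -> {set AP}) (R : S -> S -> Prop) : Prop :=
  (forall s s', R s s' -> R s' s) /\
  (forall s s', R s s' ->
     L s = L s' /\
     forall i s1, tr i s s1 -> exists2 s1', tr i s' s1' & R s1 s1').

Definition bisim (S : Type) (tr : I -> S -> S -> Prop) (L : S -> {set AP})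
    (s s' : S) : Prop :=
  exists2 R, bisimulation tr L R & R s s'.

Definition sum_trans A B (i : I) (x y : ts_state A + ts_state B) : Prop :=
  match x, y with
  | inl x', inl y' => ts_trans i x' y'
  | inr x', inr y' => ts_trans i x' y'
  | _, _ => False
  end.

Definition sum_label A B (x : ts_state A + ts_state B) : {set AP} :=
  match x with inl x' => ts_label x' | inr x' => ts_label x' end.

Definition bisimilar A B : Prop :=
  bisim (@sum_trans A B) (@sum_label A B) (inl (ts_init A)) (inr (ts_init B)).

End TransitionSystems.

Section Semantics.
Variables (V : finType) (Lg : language V) (M : model Lg).
Variable AP : {fset predicate Lg}.

Definition init_val : valuation V := [ffun=> 0%R].

Definition cmd_trans (i : 'I_(ncmd M)) (s s' : valuation V) : Prop :=
  holds s (guard i) /\ s' = assign (update i) s.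

Definition props (s : valuation V) : {set AP} := [set p : AP | holds s (val p)].

Lemma cmd_trans_det i s s1 s2 : cmd_trans i s s1 -> cmd_trans i s s2 -> s1 = s2.
Proof. by move=> [_ ->] [_ ->]. Qed.

Definition semantics : transition_system 'I_(ncmd M) AP :=
  @TransitionSystem 'I_(ncmd M) AP (valuation V) cmd_trans init_val props
    cmd_trans_det.

Definition satisfies (s : valuation V) (phi : formula AP) : Prop :=
  feval (fun p => holds s (val p)) phi.

Definition valid (f : formula (predicate Lg)) : Prop :=
  forall s : valuation V, feval (holds s) f.

(* prover f = false covers both "not valid" and "undecided". *)
Definition sound_prover (prover : formula (predicate Lg) -> bool) : Prop :=
  forall f, prover f -> valid f.

Definition bitvec (Phi : {fset predicate Lg}) : finType := {ffun Phi -> bool}.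

Definition alpha (Phi : {fset predicate Lg}) (s : valuation V) : bitvec Phi :=
  [ffun p : Phi => holds s (val p)].

Definition bitvec_formula (Phi : {fset predicate Lg}) (b : bitvec Phi) :
    formula (predicate Lg) :=
  FAnd (fconj [seq FAtom (val p) | p <- enum {: Phi} & b p])
       (fconj [seq FNot (FAtom (val p)) | p <- enum {: Phi} & ~~ b p]).

Definition formula_subst (f : formula (predicate Lg)) (e : V -> expr Lg) :=
  fmap_atoms (fun p => subst p e) f.

Section Search.
Variable prover : formula (predicate Lg) -> bool.
Variable Phi : {fset predicate Lg}.

(* sr_parent records (s, s') when s' is put in Wait while exploring s.  The   *)
(* value of sr_label on a not yet explored abstract state is irrelevant.      *)
Record search := Search {
  sr_new : {fset predicate Lg};
  sr_wait : {fset valuation V};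
  sr_states : {set bitvec Phi};
  sr_trans : {set bitvec Phi * 'I_(ncmd M) * bitvec Phi};
  sr_label : {ffun bitvec Phi -> {set AP}};
  sr_parent : {fset valuation V * valuation V}
}.

Definition search_init : search :=
  Search Phi [fset init_val] [set alpha Phi init_val]%SET set0
         [ffun=> set0] fset0.

Definition add_unless_valid (f : formula (predicate Lg))
    (ps Q : {fset predicate Lg}) : {fset predicate Lg} :=
  if prover f then Q else Q `|` ps.

Definition search_cmd (s : valuation V) (c : search) (i : 'I_(ncmd M)) :
    search :=
  let g := guard i in
  let a := bitvec_formula (alpha Phi s) in
  if holds s g then
    let s' := assign (update i) s in
    let b := alpha Phi s' in
    let wp := formula_subst (bitvec_formula b) (update i) in
    Search
      (add_unless_valid (FImp a wp) [fset p in atoms wp]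
        (add_unless_valid (FImp a (FAtom g)) [fset g] (sr_new c)))
      (if b \in sr_states c then sr_wait c else s' |` sr_wait c)
      (b |: sr_states c)%SET
      ((alpha Phi s, i, b) |: sr_trans c)%SET
      (sr_label c)
      (if b \in sr_states c then sr_parent c else (s, s') |` sr_parent c)
  else
    Search
      (add_unless_valid (FImp a (FNot (FAtom g))) [fset g] (sr_new c))
      (sr_wait c) (sr_states c) (sr_trans c) (sr_label c) (sr_parent c).

Definition search_take (s : valuation V) (c : search) : search :=
  Search (sr_new c) (sr_wait c `\ s) (sr_states c) (sr_trans c)
    [ffun a => if a == alpha Phi s then props s else sr_label c a]
    (sr_parent c).

Definition search_explore (s : valuation V) (c : search) : search :=
  foldl (search_cmd s) (search_take s c) (enum 'I_(ncmd M)).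

(* The choice of the state taken from Wait is left nondeterministic. *)
Inductive search_run : search -> Prop :=
| Search_start : search_run search_init
| Search_iter c s : search_run c -> s \in sr_wait c ->
    search_run (search_explore s c).

Definition search_done (c : search) : Prop := sr_wait c = fset0.

Definition search_inv (N : {fset valuation V}) (c : search) : Prop :=
  [/\ {in N &, injective (alpha Phi)},
      forall s, s \in N -> alpha Phi s \in sr_states c,
      {subset sr_wait c <= N} &
      forall a i b, (a, i, b) \in sr_trans c ->
        exists2 s, s \in N &
          a = alpha Phi s /\ b = alpha Phi (assign (update i) s)].

Lemma search_cmd_inv N s c i : search_inv N c -> s \in N ->
  exists2 N', search_inv N' (search_cmd s c i) & {subset N <= N'}.
Proof.
move=> [inj st wt tr] sN; rewrite /search_cmd; case: ifP => _; last by exists N.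
set s' := assign _ s; case: ifPn => s'S.
  exists N => //; split=> //=.
    by move=> r rN; rewrite inE st ?orbT.
  move=> a j b; rewrite !inE => /orP[/eqP[-> -> ->]|/tr //].
  by exists s.
exists (s' |` N); last by move=> r rN; rewrite !inE rN orbT.
split=> /=.
- move=> x y; rewrite !inE => /orP[/eqP->|xN] /orP[/eqP->|yN] // e.
  + by move: s'S; rewrite e st.
  + by move: s'S; rewrite -e st.
  + exact: inj.
- by move=> r; rewrite !inE => /orP[/eqP->|/st->]; rewrite ?eqxx ?orbT.
- by move=> r; rewrite !inE => /orP[->//|/wt->]; rewrite orbT.
- move=> a j b; rewrite !inE => /orP[/eqP[-> -> ->]|/tr[r rN H]].
    by exists s; rewrite // !inE sN orbT.
  by exists r; rewrite // !inE rN orbT.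
Qed.

Lemma search_run_inv c : search_run c ->
  exists2 N, search_inv N c & init_val \in N.
Proof.
elim=> [|{}c s _ [N inv iN] sw].
  exists [fset init_val]; last by rewrite inE.
  split=> /=.
  - by move=> x y; rewrite !inE => /eqP-> /eqP->.
  - by move=> s; rewrite !inE => /eqP->.
  - by [].
  - by move=> a i b; rewrite inE.
have sN : s \in N by case: inv => _ _ wt _; exact: wt.
have {}inv : search_inv N (search_take s c).
  case: inv => inj st wt tr; split=> //= r.
  by rewrite !inE => /andP[_ /wt].
rewrite /search_explore; elim: (enum _) (search_take s c) N inv iN sN => /=.
  by move=> d N inv iN _; exists N.
move=> i l IH d N inv iN sN.
by have [N' inv' sub] := search_cmd_inv i inv sN; apply: IH inv' _ _; apply: sub.
Qed.

Lemma search_run_init c : search_run c -> alpha Phi init_val \in sr_states c.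
Proof. by case/search_run_inv => N [_ st _ _] /st. Qed.

Lemma search_run_det c : search_run c -> forall i a b1 b2,
  (a, i, b1) \in sr_trans c -> (a, i, b2) \in sr_trans c -> b1 = b2.
Proof.
case/search_run_inv => N [inj _ _ tr] _ i a b1 b2.
move=> /tr[s sN [as_ ->]] /tr[r rN [ar ->]].
by rewrite (inj s r) // -as_ -ar.
Qed.

Definition abs_state (c : search) : Type := {a : bitvec Phi | a \in sr_states c}.

Definition abs_trans (c : search) (i : 'I_(ncmd M)) (x y : abs_state c) : Prop :=
  (val x, i, val y) \in sr_trans c.

Lemma abs_trans_det c : search_run c -> forall i (x y z : abs_state c),
  abs_trans i x y -> abs_trans i x z -> y = z.
Proof.
by move=> run i x y z xy xz; apply: val_inj; apply: search_run_det xy xz.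
Qed.

Definition abs_system (c : search) (run : search_run c) :
    transition_system 'I_(ncmd M) AP :=
  @TransitionSystem 'I_(ncmd M) AP (abs_state c) (@abs_trans c)
    (exist _ (alpha Phi init_val) (search_run_init run))
    (fun x => sr_label c (val x))
    (abs_trans_det run).

End Search.

Definition label_satisfies (l : {set AP}) (phi : formula AP) : Prop :=
  feval (fun p => p \in l) phi.

Definition error_reachable (A : transition_system 'I_(ncmd M) AP)
    (phi : formula AP) : Prop :=
  exists2 x : ts_state A, ts_reachable x & label_satisfies (ts_label x) phi.

(* The concrete states met along parent pointers, from the initial state to   *)
(* the visited state from which an abstract error state was created.          *)
Definition counter_example (prover : formula (predicate Lg) -> bool)
    (Phi : {fset predicate Lg}) (c : search Phi)
    (run : search_run prover c) (phi : formula AP)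
    (t : seq (valuation V)) : Prop :=
  exists (x : ts_state (abs_system run)) (p : seq (valuation V)),
    [/\ ts_reachable x, label_satisfies (ts_label x) phi, t = init_val :: p,
        path (fun s s' => (s, s') \in sr_parent c) init_val p &
        alpha Phi (last init_val p) = val x].

(* Unreachable also carries the abstract system of the last iteration.        *)
Inductive outcome : Type :=
| CounterExample of seq (valuation V)
| Unreachable of transition_system 'I_(ncmd M) AP.

(* refinement_from Phi r: the loop, entered with the current set of           *)
(* predicates Phi, terminates and returns r.                                  *)
Inductive refinement_from (prover : formula (predicate Lg) -> bool)
    (phi : formula AP) : {fset predicate Lg} -> outcome -> Prop :=
| Refinement_error Phi (c : search Phi) (run : search_run prover c) t :
    search_done c -> error_reachable (abs_system run) phi ->
    counter_example run phi t ->
    refinement_from prover phi Phi (CounterExample t)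
| Refinement_stable Phi (c : search Phi) (run : search_run prover c) :
    search_done c -> ~ error_reachable (abs_system run) phi ->
    sr_new c = Phi ->
    refinement_from prover phi Phi (Unreachable (abs_system run))
| Refinement_loop Phi (c : search Phi) (run : search_run prover c) r :
    search_done c -> ~ error_reachable (abs_system run) phi ->
    sr_new c <> Phi -> refinement_from prover phi (sr_new c) r ->
    refinement_from prover phi Phi r.

Definition RefinementSearch (prover : formula (predicate Lg) -> bool)
    (phi : formula AP) (r : outcome) : Prop :=
  refinement_from prover phi AP r.

End Semantics.

(* Main.v *)
(** A prover failure on [alpha s => f], for [s] satisfying [f], adds the atoms
    of [f] to the new predicates; when these are already in [Phi], the truth
    value of [f] is a function of the abstract state, so the implication was
    valid after all.  Hence at a fixpoint of the refinement, every guard and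
    every abstract successor at an explored state depends only on its
    abstraction, and the graph of [alpha Phi] is a bisimulation.  A parent
    pointer is always a concrete transition, and labels are functions of the
    abstract state because [AP] is contained in every [Phi]: counter-examples
    are therefore real, whatever the prover decided. *)

Require Import Defs.
From mathcomp Require Import all_boot all_order all_algebra finmap.

Set Implicit Arguments.
Unset Strict Implicit.
Unset Printing Implicit Defensive.

Local Open Scope fset_scope.

(** * Evaluation of formulas *)

Lemma eq_in_feval (A : eqType) (v w : A -> bool) (f : formula A) :
  {in atoms f, v =1 w} -> feval v f = feval w f.
Proof.
elim: f => //= [p|f IHf|f IHf g IHg|f IHf g IHg|f IHf g IHg].
- by apply; rewrite inE.
- by move=> /IHf->.
all: by move=> vw; rewrite IHf ?IHg // => p pfg; apply: vw;
  rewrite mem_cat pfg ?orbT.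
Qed.

Lemma eq_feval (A : Type) (v w : A -> bool) (f : formula A) :
  v =1 w -> feval v f = feval w f.
Proof. by move=> vw; elim: f => //= [f ->|f -> g ->|f -> g ->|f -> g ->]. Qed.

Lemma feval_fmap (A B : Type) (h : A -> B) (v : B -> bool) (f : formula A) :
  feval v (fmap_atoms h f) = feval (v \o h) f.
Proof. by elim: f => //= [f ->|f -> g ->|f -> g ->|f -> g ->]. Qed.

Lemma feval_fconj (A : Type) (v : A -> bool) (fs : seq (formula A)) :
  feval v (fconj fs) = all (feval v) fs.
Proof. by elim: fs => //= f fs ->. Qed.

(** * Paths, and reachability across a bisimulation *)

Lemma ts_path_rcons (I AP : finType) (A : transition_system I AP)
    (x : ts_state A) p y :
  ts_path x (rcons p y) <-> ts_path x p /\ exists i, ts_trans i (last x p) y.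
Proof.
elim: p x => [|z p IHp] x /=; first by tauto.
by rewrite IHp; tauto.
Qed.

(** Induction on the path in [B], extended at its end. Symmetry of the bisimulation lets [A] answer
    each move of [B], and no transition of the disjoint union crosses sides, so the answers form a
    path in [A]. *)
Lemma bisimilar_reachable (I AP : finType) (A B : transition_system I AP) :
  bisimilar A B -> forall y : ts_state B, ts_reachable y ->
  exists2 x : ts_state A, ts_reachable x & ts_label x = ts_label y.
Proof.
case=> R [symR simR] Rinit y [q qpath <-].
suff [x reach_x Rx]: exists2 x : ts_state A, ts_reachable x
    & R (inl x) (inr (last (ts_init B) q)).
  by exists x => //; case: (simR _ _ Rx).
elim/last_ind: q qpath => [_|q z IHq] /=.
  by exists (ts_init A) => //; exists [::].
case/ts_path_rcons => /IHq[x [p ppath px] Rx] [i qz].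
rewrite last_rcons; have [_ /(_ i (inr z) qz)] := simR _ _ (symR _ _ Rx).
case=> -[x'|//] /= xx' Rx'; exists x'; last exact: symR.
exists (rcons p x'); last by rewrite last_rcons.
by apply/ts_path_rcons; split=> //; exists i; rewrite px.
Qed.

(** * Agreement on predicates and abstract states *)

Section Search.
Variables (V : finType) (Lg : language V) (M : model Lg).
Variable AP : {fset predicate Lg}.
Variable prover : formula (predicate Lg) -> bool.
Hypothesis prover_sound : sound_prover prover.

Definition agree (Q : {fset predicate Lg}) (r s : valuation V) : Prop :=
  {in Q, holds r =1 holds s}.

Lemma agree_sub P Q r s : P `<=` Q -> agree Q r s -> agree P r s.
Proof. by move=> /fsubsetP PQ rs p /PQ/rs. Qed.

Lemma alphaP Q r s : agree Q r s <-> alpha Q r = alpha Q s.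
Proof.
split=> [rs|/ffunP e p pQ].
  by apply/ffunP=> p; rewrite !ffunE; apply: rs (valP p).
by have := e [` pQ]; rewrite !ffunE.
Qed.

Lemma agree_props r s : agree AP r s -> props AP r = props AP s.
Proof. by move=> rs; apply/setP=> p; rewrite !inE; apply: rs (valP p). Qed.

Lemma label_satisfies_props s (phi : formula AP) :
  label_satisfies (props AP s) phi <-> satisfies s phi.
Proof.
rewrite /label_satisfies /satisfies.
by rewrite (eq_feval (w := fun p => holds s (val p))) // => p; rewrite inE.
Qed.

Lemma feval_bitvec (Q : {fset predicate Lg}) (b : bitvec Q) s :
  feval (holds s) (bitvec_formula b) = (alpha Q s == b).
Proof.
rewrite /= !feval_fconj !all_map; apply/andP/eqP=> [[/allP pos /allP neg]|<-].
  apply/ffunP=> p; rewrite ffunE; case bp: (b p).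
    by apply: pos; rewrite mem_filter bp mem_enum.
  by apply/negbTE/neg; rewrite mem_filter bp mem_enum.
by split; apply/allP=> p; rewrite mem_filter ffunE => /andP[].
Qed.

Lemma feval_wp (Q : {fset predicate Lg}) (b : bitvec Q) s (e : V -> expr Lg) :
  feval (holds s) (formula_subst (bitvec_formula b) e)
  = (alpha Q (assign e s) == b).
Proof.
by rewrite feval_fmap -feval_bitvec; apply: eq_feval => p /=; rewrite substP.
Qed.

(** * Invariants of a single search *)

Variable Phi : {fset predicate Lg}.
Hypothesis APsub : AP `<=` Phi.
Notation search := (search M AP Phi).
Implicit Types (c d : search) (r s : valuation V) (i : 'I_(ncmd M)).

Lemma add_unless_valid_sub f ps Q : Q `<=` add_unless_valid prover f ps Q.
Proof. by rewrite /add_unless_valid; case: ifP; rewrite ?fsubsetUl. Qed.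

(** If the prover succeeds, soundness applies at [r], which has the abstraction of [s] because [Phi]
    lies in [Q]; if it fails, [r] and [s] agree on every atom of [f]. Used with [f] a guard, a
    negated guard, or a weakest precondition. *)
Lemma feval_add_unless_valid f (ps Q : {fset predicate Lg}) r s :
  {subset atoms f <= ps} -> Phi `<=` Q -> feval (holds s) f ->
  agree (add_unless_valid prover
    (FImp (bitvec_formula (alpha Phi s)) f) ps Q) r s ->
  feval (holds r) f.
Proof.
move=> fps PhiQ sf; rewrite /add_unless_valid; case: ifP => [pr rs|_ rs].
  have /implyP : feval (holds r) (bitvec_formula (alpha Phi s))
      ==> feval (holds r) f := prover_sound pr r.
  by apply; rewrite feval_bitvec; apply/eqP/alphaP/(agree_sub PhiQ).
rewrite (eq_in_feval (w := holds s)) // => p /fps pps.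
by apply: rs; rewrite inE pps orbT.
Qed.

(* Monotone in [Q], so it survives the growth of [sr_new] during the search;
   for [Q = Phi], agreement is equality of the abstractions. *)
Definition decided (Q : {fset predicate Lg}) s i : Prop :=
  forall r, agree Q r s -> holds r (guard i) = holds s (guard i) /\
    (holds s (guard i) ->
     alpha Phi (assign (update i) r) = alpha Phi (assign (update i) s)).

Definition step_done c s i : Prop :=
  decided (sr_new c) s i /\
  (holds s (guard i) ->
   (alpha Phi s, i, alpha Phi (assign (update i) s)) \in sr_trans c).

Definition explored c s : Prop :=
  sr_label c (alpha Phi s) = props AP s /\ forall i, step_done c s i.

Record sound c : Prop := Sound {
  sound_new : Phi `<=` sr_new c;
  sound_parent : forall s s', (s, s') \in sr_parent c ->
    exists i, cmd_trans i s s';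
  sound_trans : forall a i b, (a, i, b) \in sr_trans c ->
    b \in sr_states c /\ exists s, [/\ a = alpha Phi s, holds s (guard i),
      b = alpha Phi (assign (update i) s) & decided (sr_new c) s i]
}.

(** Between iterations [P] is [explored c]. While [s] is being explored it also admits [s], which
    has left [Wait] with only some of its commands treated. *)
Definition covered (P : valuation V -> Prop) c : Prop :=
  forall b, b \in sr_states c ->
    exists2 s, alpha Phi s = b & s \in sr_wait c \/ P s.

Lemma decided_sub P Q s i : P `<=` Q -> decided P s i -> decided Q s i.
Proof. by move=> PQ dec r /(agree_sub PQ)/dec. Qed.

(** Growth within the exploration of one state: labels stay fixed because only [search_take] writes
    them. *)
Record extends c d : Prop := Extends {
  extends_new : sr_new c `<=` sr_new d;
  extends_trans : {subset sr_trans c <= sr_trans d};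
  extends_label : sr_label c = sr_label d
}.

Lemma extends_trans3 c1 c2 c3 : extends c1 c2 -> extends c2 c3 -> extends c1 c3.
Proof.
case=> n1 t1 l1 [n2 t2 l2]; split; first exact: fsubset_trans n1 n2.
  by move=> x /t1/t2.
by rewrite l1.
Qed.

Lemma step_done_extends c d s i : extends c d -> step_done c s i ->
  step_done d s i.
Proof. by case=> n t _ [/(decided_sub n) ? tr]; split=> // /tr/t. Qed.

Lemma search_cmd_extends s c i : extends c (search_cmd prover s c i).
Proof.
rewrite /search_cmd; case: ifP => _; split=> //=.
- by apply: fsubset_trans (add_unless_valid_sub _ _ _);
    apply: add_unless_valid_sub.
- by move=> x xc; rewrite inE xc orbT.
- exact: add_unless_valid_sub.
Qed.

Lemma search_cmd_decided s c i : Phi `<=` sr_new c ->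
  decided (sr_new (search_cmd prover s c i)) s i.
Proof.
move=> PhiQ r; rewrite /search_cmd.
have atom_sub (p : predicate Lg) : {subset [:: p] <= [fset p]}.
  by move=> q; rewrite !inE.
case: ifP => /= [sg rs|sg rs].
  have rg := feval_add_unless_valid (f := FAtom (guard i)) (@atom_sub _) PhiQ
    sg (agree_sub (add_unless_valid_sub _ _ _) rs).
  (* Equality of the successor abstractions becomes truth at [r] of the very formula submitted to
     the prover. *)
  split=> // _; apply/eqP; rewrite -feval_wp.
  apply: feval_add_unless_valid rs; last by rewrite feval_wp.
    by move=> p; rewrite in_fset.
  exact: fsubset_trans PhiQ (add_unless_valid_sub _ _ _).
split=> //; apply/negbTE.
apply: (feval_add_unless_valid (f := FNot (FAtom (guard i)))) rs => //=.
by rewrite sg.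
Qed.

Lemma search_cmd_done s c i : Phi `<=` sr_new c ->
  step_done (search_cmd prover s c i) s i.
Proof.
move=> PhiQ; split; first exact: search_cmd_decided.
by rewrite /search_cmd => sg; rewrite sg /= !inE eqxx.
Qed.

Lemma search_cmd_sound s c i : sound c -> sound (search_cmd prover s c i).
Proof.
move=> [new par tr]; have ext := search_cmd_extends s c i.
have dec := search_cmd_decided (s := s) (i := i) new.
have decS r j : decided (sr_new c) r j ->
  decided (sr_new (search_cmd prover s c i)) r j.
  exact: decided_sub (extends_new ext).
split; first exact: fsubset_trans new (extends_new ext).
- rewrite /search_cmd; case: ifP => //= sg; case: ifP => //= _ r r'.
  by rewrite !inE => /orP[/eqP[-> ->]|/par //]; exists i.
- move: dec decS; rewrite /search_cmd; case: ifP => /= sg dec decS a j b.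
    rewrite !inE => /orP[/eqP[-> -> ->]|/tr[bS [r [-> rg eb /decS rd]]]].
      by rewrite eqxx; split=> //; exists s.
    by rewrite bS orbT; split=> //; exists r.
  by case/tr=> bS [r [-> rg eb /decS rd]]; split=> //; exists r.
Qed.

Lemma explored_extends c d s : extends c d -> explored c s -> explored d s.
Proof.
move=> ext [lab steps]; split; first by rewrite -(extends_label ext).
by move=> i; apply: step_done_extends ext (steps i).
Qed.

(** A command removes nothing from [Wait], and a new abstract state enters together with a waiting
    representative. *)
Lemma search_cmd_covered s c i :
  covered (fun r => r = s \/ explored c r) c ->
  covered (fun r => r = s \/ explored (search_cmd prover s c i) r)
    (search_cmd prover s c i).
Proof.
set d := search_cmd _ _ _ _ => cov.
have ext : extends c d := search_cmd_extends s c i.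
have [new_wait wait_sub] : (forall b, b \in sr_states d ->
    b \in sr_states c \/ exists2 s', alpha Phi s' = b & s' \in sr_wait d)
    /\ {subset sr_wait c <= sr_wait d}.
  rewrite /d /search_cmd; case: ifP => _ /=; last by split=> // b; left.
  case: ifPn => s'S; split=> //.
  - by move=> b; rewrite in_setU1 => /orP[/eqP->|]; left.
  - move=> b; rewrite in_setU1 => /orP[/eqP->|]; last by left.
    by right; exists (assign (update i) s); rewrite // !inE eqxx.
  - by move=> r rw; rewrite !inE rw orbT.
move=> b /new_wait[/cov[r rb rP]|[r rb rw]]; exists r => //; last by left.
case: rP => [/wait_sub|[]]; [by left | by right; left | move=> rE].
by right; right; apply: explored_extends ext rE.
Qed.

Lemma search_fold s c (l : seq 'I_(ncmd M)) :
    sound c -> covered (fun r => r = s \/ explored c r) c ->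
  let d := foldl (search_cmd prover s) c l in
  [/\ sound d, extends c d, covered (fun r => r = s \/ explored d r) d
    & forall i, i \in l -> step_done d s i].
Proof.
elim: l c => [|i l IHl] c sc cov /=.
  by split=> //; split=> //; apply: fsubset_refl.
have ext1 := search_cmd_extends s c i.
have [sd ext2 covd steps] :=
  IHl _ (search_cmd_sound s i sc) (@search_cmd_covered s c i cov).
split=> //; first exact: extends_trans3 ext1 ext2.
move=> j; rewrite inE => /predU1P[->|/steps //].
by apply: step_done_extends ext2 _; apply: search_cmd_done; apply: sound_new sc.
Qed.

Lemma search_take_covered s c : covered (explored c) c ->
  covered (fun r => r = s \/ explored (search_take s c) r) (search_take s c).
Proof.
move=> cov b /cov[r rb rP]; exists r => //; have [->|rs] := eqVneq r s.
  by right; left.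
case: rP => [rw|[lab steps]]; first by left; rewrite !inE rs.
(* Taking [s] may overwrite the label written for an explored [r] with the same abstraction; as [AP]
   lies in [Phi], the two labels coincide. *)
right; right; split=> //=; rewrite ffunE; case: eqP => // /alphaP r_s.
by apply/esym/agree_props/(agree_sub APsub).
Qed.

Lemma search_run_sound c : search_run prover c ->
  sound c /\ covered (explored c) c.
Proof.
elim=> [|{}c s _ [sc cov] sw].
  split; last first.
    move=> b; rewrite /= inE => /eqP->; exists (init_val V) => //.
    by left; rewrite !inE.
  split=> /=; first exact: fsubset_refl.
    by move=> s s'; rewrite inE.
  by move=> a i b; rewrite inE.
have st : sound (search_take s c) by case: sc.
have [sd ext covd steps] :=
  search_fold (enum 'I_(ncmd M)) st (search_take_covered (s := s) cov).
(* Once all commands are treated, [s] is itself explored, which removes the exceptional case from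
   [covered]. *)
have sE : explored (search_explore prover s c) s.
  split; first by rewrite -(extends_label ext) ffunE eqxx.
  by move=> i; apply: steps; rewrite mem_enum.
split=> // b /covd[r rb [rw|[rs|rE]]]; exists r => //; [by left| |by right].
by right; rewrite rs.
Qed.

(** * Finished searches and the bisimulation at a fixpoint *)

Section Done.
Variables (c : search) (run : search_run prover c).
Hypothesis c_done : search_done c.

Lemma search_done_explored b : b \in sr_states c ->
  exists2 s, alpha Phi s = b & explored c s.
Proof.
case: (search_run_sound run) => _ cov /cov[s sb [|sE]]; last by exists s.
by rewrite c_done inE.
Qed.

Lemma search_done_label s b : b \in sr_states c -> alpha Phi s = b ->
  sr_label c b = props AP s.
Proof.
move=> bS sb; have [r rb [lab _]] := search_done_explored bS.
rewrite -rb lab; apply/agree_props/(agree_sub APsub)/alphaP.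
by rewrite sb.
Qed.

Lemma parent_path s p : path (fun r r' => (r, r') \in sr_parent c) s p ->
  ts_path (A := semantics M AP) s p.
Proof.
have [sc _] := search_run_sound run.
by elim: p s => //= r p IHp s /andP[/(sound_parent sc) ? /IHp].
Qed.

Lemma counter_example_sound phi t : counter_example run phi t ->
  ts_execution (A := semantics M AP) t /\
  satisfies (last (init_val V) t) phi.
Proof.
case=> -[b bS] [p [_ bphi -> /parent_path ppath pb]]; split=> //=.
by apply/label_satisfies_props; rewrite -(search_done_label bS pb).
Qed.

Section Stable.
Hypothesis new_Phi : sr_new c = Phi.

(** The transition was recorded from some [r] with the abstraction of [s]. With [sr_new c = Phi],
    [decided] at [r] applies to [s]. *)
Lemma search_stable_sim (x y : abs_state c) s i : val x = alpha Phi s ->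
  abs_trans i x y ->
  cmd_trans i s (assign (update i) s) /\
  val y = alpha Phi (assign (update i) s).
Proof.
have [sc _] := search_run_sound run.
move=> xs /(sound_trans sc)[_ [r [xr rg -> dec]]].
have [|sg upd] := dec s; first by rewrite new_Phi; apply/alphaP; rewrite -xs.
by split; [split=> //; rewrite sg | rewrite upd].
Qed.

(** Here [r] is an explored representative of [x]: the guard carries over from [s] to [r], so the
    transition was recorded while exploring [r]. *)
Lemma search_stable_cosim (x : abs_state c) s s' i : val x = alpha Phi s ->
  cmd_trans i s s' -> exists2 y : abs_state c, abs_trans i x y
    & val y = alpha Phi s'.
Proof.
have [sc _] := search_run_sound run.
case: x => b bS /= bs [sg ->]; have [r rb [_ /(_ i)[dec tr]]] :=
  search_done_explored bS.
have [|rg upd] := dec s; first by rewrite new_Phi; apply/alphaP; rewrite -bs.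
rewrite rg in sg; have {}tr := tr sg; have [b'S _] := sound_trans sc tr.
exists (exist (fun b' => b' \in sr_states c) _ b'S).
  by rewrite /abs_trans /= -rb.
by rewrite /= upd.
Qed.

Lemma search_stable_bisimilar : bisimilar (abs_system run) (semantics M AP).
Proof.
(* The graph of [alpha Phi], taken in both directions to be symmetric on the disjoint union. *)
pose R (x y : ts_state (abs_system run) + ts_state (semantics M AP)) : Prop :=
  match x, y with
  | inl x', inr s | inr s, inl x' => val x' = alpha Phi s
  | _, _ => False
  end.
exists R => //; split=> [[x|s] [y|r]|[x|s] [y|r]] //= e; split.
- exact: search_done_label (valP x) (esym e).
- move=> i [y' xy'|//]; have [sr y's] := search_stable_sim e xy'.
  by exists (inr (assign (update i) r)).
- by apply/esym/(search_done_label (valP y)).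
- move=> i [//|s'] ss'; have [y' yy' e'] := search_stable_cosim e ss'.
  by exists (inl y').
Qed.

End Stable.
End Done.
End Search.

(** * The refinement loop *)

Lemma refinement_from_sound (V : finType) (Lg : language V) (M : model Lg)
    (AP : {fset predicate Lg}) (phi : formula AP)
    (prover : formula (predicate Lg) -> bool) Phi (r : outcome M AP) :
  sound_prover prover -> refinement_from prover phi Phi r -> AP `<=` Phi ->
  match r with
  | CounterExample t => ts_execution (A := semantics M AP) t /\
      satisfies (last (init_val V) t) phi
  | Unreachable A => bisimilar A (semantics M AP) /\ ~ error_reachable A phi
  end.
Proof.
move=> prover_sound; elim=> {r}.
- by move=> {}Phi c run t c_done _ cex sub; apply: counter_example_sound cex.
- move=> {}Phi c run c_done noerr stable sub; split=> //.
  exact: search_stable_bisimilar.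
(* Predicates only accumulate, so the next iteration still contains [AP]. *)
- move=> {}Phi c run r _ _ _ _ IHr sub; apply: IHr.
  have [sc _] := search_run_sound prover_sound sub run.
  exact: fsubset_trans sub (sound_new sc).
Qed.

Theorem theorem1 (V : finType) (Lg : language V) (M : model Lg)
    (AP : {fset predicate Lg}) (phi : formula AP)
    (prover : formula (predicate Lg) -> bool)
    (prover_sound : sound_prover prover) :
  (forall t : seq (valuation V),
     RefinementSearch prover phi (CounterExample M AP t) ->
     [/\ ts_execution (A := semantics M AP) t,
         satisfies (last (init_val V) t) phi &
         exists2 s : valuation V,
           ts_reachable (A := semantics M AP) s & satisfies s phi]) /\
  (forall A : transition_system 'I_(ncmd M) AP,
     RefinementSearch prover phi (Unreachable A) ->
     (forall s : valuation V,
        ts_reachable (A := semantics M AP) s -> ~ satisfies s phi) /\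
     bisimilar A (semantics M AP)).
Proof.
split=> [t|A] /(refinement_from_sound prover_sound) /(_ (fsubset_refl _)).
  case=> exec tphi; split=> //; exists (last (init_val V) t) => //.
  by case: t exec {tphi} => // s p [-> ppath]; exists p.
(* A reachable concrete error would have a reachable abstract counterpart with the same label. *)
case=> bis noerr; split=> // s s_reach sphi; apply: noerr.
have [x x_reach xs] := bisimilar_reachable bis s_reach.
by exists x => //; rewrite xs; apply/label_satisfies_props.
Qed.
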